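(* Let $d\in\mathbb{N}^*$, let $a<b$ be reals, let $0<\alpha\le 1$, let $N\ge 2$ be an integer, $h=(b-a)/N$, $t_k=a+kh$ for $k=0,\ldots,N$. Let $L:\mathbb{R}^d\times\mathbb{R}^d\times[a,b]\to\mathbb{R}$, $(x,v,t)\mapsto L(x,v,t)$, be a Lagrangian (a $C^2$ map) which is $\Delta^\alpha_-$-invariant under the action of a one parameter group of diffeomorphisms $\Phi=\{\phi(s,\cdot)\}_{s\in\mathbb{R}}$ of $\mathbb{R}^d$. Then, for any solution $\boldsymbol{Q}=(Q_k)_{k=0,\ldots,N}\in(\mathbb{R}^d)^{N+1}$ of the discrete fractional Euler-Lagrange equation $$\forall k=1,\ldots,N-1,\qquad \frac{\partial L}{\partial x}\big(Q_k,(\Delta^\alpha_-\boldsymbol{Q})_k,t_k\big)+\Delta^\alpha_+\left(\frac{\partial L}{\partial v}(\boldsymbol{Q},\Delta^\alpha_-\boldsymbol{Q},\boldsymbol{T})\right)_k=0,$$ the following equality holds for every $k=1,\ldots,N-1$: $$\Delta^\alpha_-\left(\frac{\partial\phi}{\partial s}(0,\boldsymbol{Q})\right)_k\cdot\frac{\partial L}{\partial v}\big(Q_k,(\Delta^\alpha_-\boldsymbol{Q})_k,t_k\big)-\frac{\partial\phi}{\partial s}(0,Q_k)\cdot\Delta^\alpha_+\left(\frac{\partial L}{\partial v}(\boldsymbol{Q},\Delta^\alpha_-\boldsymbol{Q},\boldsymbol{T})\right)_k=0 .$$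
   Context: Coefficients: $\alpha_0:=1$ and, for every integer $r\ge 1$, $\alpha_r:=\dfrac{(-\alpha)(1-\alpha)\cdots(r-1-\alpha)}{r!}$. Discrete fractional derivatives (Grünwald-Letnikov): for $\boldsymbol{Q}=(Q_k)_{k=0,\ldots,N}\in(\mathbb{R}^d)^{N+1}$, $$(\Delta^\alpha_-\boldsymbol{Q})_k:=\frac{1}{h^\alpha}\sum_{r=0}^{k}\alpha_r Q_{k-r}\ \ (k=1,\ldots,N),\qquad (\Delta^\alpha_+\boldsymbol{Q})_k:=\frac{1}{h^\alpha}\sum_{r=0}^{N-k}\alpha_r Q_{k+r}\ \ (k=0,\ldots,N-1).$$ $\boldsymbol{T}:=(t_k)_{k=0,\ldots,N}$. Functions of discrete elements are understood componentwise: $\phi(s,\boldsymbol{Q})=(\phi(s,Q_k))_{k=0,\ldots,N}$, $\frac{\partial\phi}{\partial s}(0,\boldsymbol{Q})=\big(\frac{\partial\phi}{\partial s}(0,Q_k)\big)_{k=0,\ldots,N}$, and the $k$-th entry of $\frac{\partial L}{\partial v}(\boldsymbol{Q},\Delta^\alpha_-\boldsymbol{Q},\boldsymbol{T})$ is $P_k:=\frac{\partial L}{\partial v}\big(Q_k,(\Delta^\alpha_-\boldsymbol{Q})_k,t_k\big)$ for $k=1,\ldots,N$; for $1\le k\le N-1$, $\Delta^\alpha_+(\cdot)_k$ of it is $\frac{1}{h^\alpha}\sum_{r=0}^{N-k}\alpha_r P_{k+r}$, which only involves entries with index $\ge1$. Here $\frac{\partial L}{\partial x}$ and $\frac{\partial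 L}{\partial v}$ are the gradients with respect to the first and second $\mathbb{R}^d$ variables, and $\cdot$ is the Euclidean inner product of $\mathbb{R}^d$. One parameter group of diffeomorphisms: a family $\Phi=\{\phi(s,\cdot)\}_{s\in\mathbb{R}}$ of diffeomorphisms $\phi(s,\cdot):\mathbb{R}^d\to\mathbb{R}^d$ such that (1) $\phi(0,\cdot)=\mathrm{Id}_{\mathbb{R}^d}$; (2) $\phi(s,\cdot)\circ\phi(s',\cdot)=\phi(s+s',\cdot)$ for all $s,s'\in\mathbb{R}$; (3) $\phi:\mathbb{R}\times\mathbb{R}^d\to\mathbb{R}^d$ is of class $C^2$. $\Delta^\alpha_-$-invariance: $L$ is said to be $\Delta^\alpha_-$-invariant under the action of $\Phi$ if for every solution $\boldsymbol{Q}\in(\mathbb{R}^d)^{N+1}$ of the discrete fractional Euler-Lagrange equation displayed in the claim and every $s\in\mathbb{R}$, $L\big(\phi(s,\boldsymbol{Q}),\Delta^\alpha_-(\phi(s,\boldsymbol{Q})),\boldsymbol{T}\big)=L(\boldsymbol{Q},\Delta^\alpha_-\boldsymbol{Q},\boldsymbol{T})$, i.e. for every $k=1,\ldots,N$, $$L\big(\phi(s,Q_k),\Delta^\alpha_-(\phi(s,\boldsymbol{Q}))_k,t_k\big)=L\big(Q_k,(\Delta^\alpha_-\boldsymbol{Q})_k,t_k\big).$$ *)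

(* Defs.v *)
From HB Require Import structures.
From mathcomp Require Import all_boot all_order all_algebra.
From mathcomp Require Import all_classical all_reals all_analysis.

Set Implicit Arguments.
Unset Strict Implicit.
Unset Printing Implicit Defensive.

Import Order.TTheory GRing.Theory Num.Theory.
Import numFieldNormedType.Exports.

Local Open Scope classical_set_scope.
Local Open Scope ring_scope.

(* For U open in a finite-dimensional V: continuity of x |-> 'd f x in operator
   norm amounts to continuity of every x |-> 'D_v f x. *)
Fixpoint Ck (R : realType) (V W : normedModType R) (k : nat)
    (U : set V) (f : V -> W) : Prop :=
  if k is k'.+1 then
    (forall x, U x -> differentiable f x) /\
    (forall v, Ck k' U (fun x => 'D_v f x))
  else forall x, U x -> {for x, continuous f}.

(* Class C^k on a subset D that need not be open: f coincides on D with a map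
   of class C^k on an open neighbourhood of D. *)
Definition Ck_on (R : realType) (V W : normedModType R) (k : nat)
    (D : set V) (f : V -> W) : Prop :=
  exists (U : set V) (g : V -> W),
    [/\ open U, D `<=` U, Ck k U g & forall x, D x -> f x = g x].

Section VectorCalculus.
Variables (R : realType) (d : nat).

Definition dotprod (u v : 'rV[R]_d) : R := \sum_(i < d) u 0 i * v 0 i.

Definition grad (f : 'rV[R]_d -> R) (x : 'rV[R]_d) : 'rV[R]_d :=
  \row_(i < d) 'D_(delta_mx 0 i) f x.

Definition diffeomorphism (f : 'rV[R]_d -> 'rV[R]_d) : Prop :=
  exists g : 'rV[R]_d -> 'rV[R]_d,
    [/\ cancel f g, cancel g f, Ck 1 setT f & Ck 1 setT g].

Definition one_parameter_group (phi : R -> 'rV[R]_d -> 'rV[R]_d) : Prop :=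
  [/\ forall s, diffeomorphism (phi s),
      phi 0 = id,
      forall s s', phi s \o phi s' = phi (s + s')
    & Ck 2 setT (fun p : R * 'rV[R]_d => phi p.1 p.2)].

(* dphi/ds (0, x) *)
Definition infinitesimal_generator (phi : R -> 'rV[R]_d -> 'rV[R]_d)
    (x : 'rV[R]_d) : 'rV[R]_d :=
  derive1 (fun s => phi s x) 0.

(* L is a function on R^d x R^d x [a, b]; as a total function of t, its values
   for t outside [a, b] are irrelevant everywhere below. *)
Definition lagrangian (a b : R) (L : 'rV[R]_d -> 'rV[R]_d -> R -> R) : Prop :=
  Ck_on 2 [set p : 'rV[R]_d * 'rV[R]_d * R | a <= p.2 <= b]
    (fun p => L p.1.1 p.1.2 p.2).

Definition dLdx (L : 'rV[R]_d -> 'rV[R]_d -> R -> R) (x v : 'rV[R]_d) (t : R) :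
  'rV[R]_d := grad (fun y => L y v t) x.

Definition dLdv (L : 'rV[R]_d -> 'rV[R]_d -> R -> R) (x v : 'rV[R]_d) (t : R) :
  'rV[R]_d := grad (fun w => L x w t) v.

End VectorCalculus.

Section Discrete.
Variables (R : realType) (d : nat) (a b alpha : R) (N : nat).

Definition step : R := (b - a) / N%:R.

Definition node (k : 'I_N.+1) : R := a + k%:R * step.

Definition GL_coef (r : nat) : R := (\prod_(j < r) (j%:R - alpha)) / (r`!)%:R.

(* The indices k - r and k + r below lie in {0, ..., N}, so [inord] is exact.
   Delta_minus is only meaningful for k >= 1 and Delta_plus for k < N; the
   remaining entries are never used. *)
Definition Delta_minus (Q : 'I_N.+1 -> 'rV[R]_d) (k : 'I_N.+1) : 'rV[R]_d :=
  (step `^ alpha)^-1 *: \sum_(r < k.+1) GL_coef r *: Q (inord (k - r)).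

Definition Delta_plus (Q : 'I_N.+1 -> 'rV[R]_d) (k : 'I_N.+1) : 'rV[R]_d :=
  (step `^ alpha)^-1 *: \sum_(r < (N - k).+1) GL_coef r *: Q (inord (k + r)).

Variable L : 'rV[R]_d -> 'rV[R]_d -> R -> R.

Definition momentum (Q : 'I_N.+1 -> 'rV[R]_d) (k : 'I_N.+1) : 'rV[R]_d :=
  dLdv L (Q k) (Delta_minus Q k) (node k).

Definition discrete_EL (Q : 'I_N.+1 -> 'rV[R]_d) : Prop :=
  forall k : 'I_N.+1, (0 < k < N)%N ->
    dLdx L (Q k) (Delta_minus Q k) (node k) + Delta_plus (momentum Q) k = 0.

Definition Delta_minus_invariant (phi : R -> 'rV[R]_d -> 'rV[R]_d) : Prop :=
  forall Q : 'I_N.+1 -> 'rV[R]_d, discrete_EL Q ->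
  forall (s : R) (k : 'I_N.+1), (0 < k)%N ->
    L (phi s (Q k)) (Delta_minus (fun j => phi s (Q j)) k) (node k) =
    L (Q k) (Delta_minus Q k) (node k).

End Discrete.

(* Main.v *)
(** Along a solution, the Lagrangian evaluated on the curve
    [s |-> (phi s Q_k, Delta_minus (phi s Q) k, t_k)] is constant by invariance.
    Differentiating at [s = 0] and using that [Delta_minus] is linear in the
    sequence, the chain rule gives [X_k . dL/dx + (Delta_minus X)_k . dL/dv = 0],
    where [X] is the infinitesimal generator along [Q]; the Euler-Lagrange
    equation replaces [dL/dx] by [- Delta_plus (dL/dv)]. *)
Require Import Defs.
From mathcomp Require Import all_boot all_order all_algebra.
From mathcomp Require Import all_classical all_reals all_analysis.

Set Implicit Arguments.
Unset Strict Implicit.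
Unset Printing Implicit Defensive.

Import Order.TTheory GRing.Theory Num.Theory.
Import numFieldNormedType.Exports.

Local Open Scope ring_scope.

Section PartialDifferentials.
Variables (R : numFieldType) (U V W : normedModType R).
Variables (f : U * V -> W) (x : U) (y : V).
Hypothesis f_diff : differentiable f (x, y).

Lemma is_diff_partial1 :
  is_diff x (fun z => f (z, y)) (fun u => 'd f (x, y) (u, 0)).
Proof.
apply: (is_diff_comp (f := fun z => (z, y)) (df := fun u => (u, 0))).
exact: differentiableP.
Qed.

Lemma is_diff_partial2 :
  is_diff y (fun z => f (x, z)) (fun v => 'd f (x, y) (0, v)).
Proof.
apply: (is_diff_comp (f := fun z => (x, z)) (df := fun v => (0, v))).
exact: differentiableP.
Qed.

Lemma diff_partials (u : U) (v : V) :
  'd f (x, y) (u, v) = 'd (fun z => f (z, y)) x u + 'd (fun z => f (x, z)) y v.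
Proof.
have [[_ ->] [_ ->]] := (is_diff_partial1, is_diff_partial2); rewrite -linearD.
by congr ('d f _ (_, _)); rewrite /= ?addr0 ?add0r.
Qed.

End PartialDifferentials.

Lemma is_derive1_diffP (R : numFieldType) (V : normedModType R)
    (c : R -> V) (s : R) (dc : V) :
  is_derive s 1 c dc <-> is_diff s c ( *:%R ^~ dc).
Proof.
split=> [[/derivable1_diffP c_diff <-]|[c_diff dcE]].
  by apply: DiffDef => //; rewrite deriv1E ?derive1E//; exact/derivable1_diffP.
apply: DeriveDef; first exact/derivable1_diffP.
by rewrite deriveE// dcE scale1r.
Qed.

Lemma is_derive1_pair (R : numFieldType) (U V : normedModType R)
    (x : R -> U) (y : R -> V) (s : R) (dx : U) (dy : V) :
  is_derive s 1 x dx -> is_derive s 1 y dy ->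
  is_derive s 1 (fun r => (x r, y r)) (dx, dy).
Proof.
move=> /is_derive1_diffP xD /is_derive1_diffP yD.
(* The [is_diff] premise is resolved by the instance [is_diff_pair]. *)
exact/is_derive1_diffP.
Qed.

Lemma is_derive1_diff_comp (R : numFieldType) (V W : normedModType R)
    (f : V -> W) (c : R -> V) (s : R) (dc : V) :
  differentiable f (c s) -> is_derive s 1 c dc ->
  is_derive s 1 (f \o c) ('d f (c s) dc).
Proof.
move=> /differentiableP fD /is_derive1_diffP cD; apply/is_derive1_diffP.
apply: is_diff_eq (is_diff_comp cD fD) _.
by apply/funext => h /=; rewrite linearZ.
Qed.

Section DotProduct.
Variables (R : realType) (d : nat).
Implicit Types u v x : 'rV[R]_d.

Lemma dotprodNr u v : dotprod u (- v) = - dotprod u v.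
Proof. by rewrite -sumrN; apply: eq_bigr => i _; rewrite mxE mulrN. Qed.

Lemma diff_grad (f : 'rV[R]_d -> R) x u :
  differentiable f x -> 'd f x u = dotprod u (grad f x).
Proof.
move=> f_diff; rewrite {1}[u]row_sum_delta linear_sum; apply: eq_bigr => i _.
by rewrite linearZ mxE deriveE.
Qed.

End DotProduct.

Section Lagrangian.
Variables (R : realType) (d : nat) (a b : R).
Variables (L : 'rV[R]_d -> 'rV[R]_d -> R -> R) (t : R).
Hypotheses (L_C2 : lagrangian a b L) (tab : a <= t <= b).

Lemma differentiable_lagrangian (p : 'rV[R]_d * 'rV[R]_d) :
  differentiable (fun q => L q.1 q.2 t) p.
Proof.
have [U [g [_ subU [g_diff _] LgE]]] := L_C2.
rewrite (_ : (fun q => _) = fun q => g (q, t)); last first.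
  by apply/funext => q; exact: (LgE (q, t)).
by have /is_diff_partial1[] := g_diff (p, t) (subU (p, t) tab).
Qed.

Lemma is_derive_lagrangian (x v : R -> 'rV[R]_d) (dx dv : 'rV[R]_d) (s : R) :
  is_derive s 1 x dx -> is_derive s 1 v dv ->
  is_derive s 1 (fun r => L (x r) (v r) t)
    (dotprod dx (dLdx L (x s) (v s) t) + dotprod dv (dLdv L (x s) (v s) t)).
Proof.
move=> xD vD; have L_diff := differentiable_lagrangian (x s, v s).
have [x_diff _] := is_diff_partial1 L_diff.
have [v_diff _] := is_diff_partial2 L_diff.
rewrite /dLdx /dLdv -!diff_grad// -(diff_partials L_diff).
exact: is_derive1_diff_comp L_diff (is_derive1_pair xD vD).
Qed.

End Lagrangian.

Lemma is_derive_infinitesimal_generator (R : realType) (d : nat)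
    (phi : R -> 'rV[R]_d -> 'rV[R]_d) (x : 'rV[R]_d) :
  one_parameter_group phi ->
  is_derive (0 : R) 1 (phi ^~ x) (infinitesimal_generator phi x).
Proof.
move=> [_ _ _ [phi_diff _]]; apply: DeriveDef; last by rewrite -derive1E.
apply/derivable1_diffP.
by have /is_diff_partial1[] := phi_diff (0, x) I.
Qed.

Section GrunwaldLetnikov.
Variables (R : realType) (d : nat) (a b alpha : R) (N : nat).
Implicit Type k : 'I_N.+1.

Lemma node_itv k : a <= b -> a <= node a b k <= b.
Proof.
move=> ab; have ba_ge0 : 0 <= b - a by rewrite subr_ge0.
rewrite /node /step lerDl mulr_ge0 ?divr_ge0 ?ler0n//=.
rewrite -lerBrDl mulrCA ler_piMr//.
have [-> | N_neq0] := eqVneq (N%:R : R) 0; first by rewrite invr0 mulr0.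
by rewrite ler_pdivrMr ?lt0r ?N_neq0 ?ler0n// mul1r ler_nat -ltnS.
Qed.

Lemma is_derive_Delta_minus (V : normedModType R) (q : V -> 'I_N.+1 -> 'rV[R]_d)
    (dq : 'I_N.+1 -> 'rV[R]_d) (x v : V) k :
  (forall j, is_derive x v (q ^~ j) (dq j)) ->
  is_derive x v (fun z => Delta_minus a b alpha (q z) k)
    (Delta_minus a b alpha dq k).
Proof.
move=> q_deriv.
have -> : (fun z => Delta_minus a b alpha (q z) k) =
    (step a b N `^ alpha)^-1 \*:
      \sum_(r < k.+1) (GL_coef alpha r \*: q ^~ (inord (k - r))).
  by apply/funext => z; rewrite /Delta_minus /= fct_sumE.
by apply: is_deriveZ; apply: is_derive_sum => r; exact: is_deriveZ.
Qed.

Lemma infinitesimal_invariance (L : 'rV[R]_d -> 'rV[R]_d -> R -> R)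
    (phi : R -> 'rV[R]_d -> 'rV[R]_d) (Q : 'I_N.+1 -> 'rV[R]_d) k :
  let X j := infinitesimal_generator phi (Q j) in
  a <= b -> lagrangian a b L -> one_parameter_group phi ->
  Delta_minus_invariant a b alpha N L phi -> discrete_EL a b alpha L Q ->
  (0 < k)%N ->
  dotprod (X k) (dLdx L (Q k) (Delta_minus a b alpha Q k) (node a b k))
    + dotprod (Delta_minus a b alpha X k)
      (dLdv L (Q k) (Delta_minus a b alpha Q k) (node a b k)) = 0.
Proof.
move=> X ab L_C2 phi_group L_inv Q_EL k_gt0.
have phi0 : phi 0 = id by case: phi_group.
have flow_deriv j : is_derive (0 : R) 1 (fun s => phi s (Q j)) (X j).
  exact: is_derive_infinitesimal_generator.
have velocity_deriv := is_derive_Delta_minus k flow_deriv.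
have lagrangian_cst :
    (fun s => L (phi s (Q k)) (Delta_minus a b alpha (fun j => phi s (Q j)) k)
      (node a b k)) = cst (L (Q k) (Delta_minus a b alpha Q k) (node a b k)).
  by apply/funext => s; exact: L_inv.
have [_] := is_derive_lagrangian L_C2 (node_itv k ab) (flow_deriv k)
  velocity_deriv.
by rewrite lagrangian_cst derive_cst phi0 => <-.
Qed.

End GrunwaldLetnikov.

Theorem theorem4 (R : realType) (d : nat) (hd : (0 < d)%N)
    (a b : R) (hab : a < b) (alpha : R) (halpha : 0 < alpha <= 1)
    (N : nat) (hN : (2 <= N)%N)
    (L : 'rV[R]_d -> 'rV[R]_d -> R -> R) (hL : lagrangian a b L)
    (phi : R -> 'rV[R]_d -> 'rV[R]_d) (hphi : one_parameter_group phi)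
    (hinv : @Delta_minus_invariant R d a b alpha N L phi)
    (Q : 'I_N.+1 -> 'rV[R]_d) (hQ : discrete_EL a b alpha L Q)
    (k : 'I_N.+1) (hk : (0 < k < N)%N) :
  dotprod
    (Delta_minus a b alpha (fun j => infinitesimal_generator phi (Q j)) k)
    (dLdv L (Q k) (Delta_minus a b alpha Q k) (node a b k))
  - dotprod
    (infinitesimal_generator phi (Q k))
    (Delta_plus a b alpha (momentum a b alpha L Q) k) = 0.
Proof.
have EL : dLdx L (Q k) (Delta_minus a b alpha Q k) (node a b k) =
    - Delta_plus a b alpha (momentum a b alpha L Q) k.
  by apply/eqP; rewrite -addr_eq0 hQ.
rewrite -dotprodNr -EL addrC.
by apply: infinitesimal_invariance => //; [exact: ltW | case/andP: hk].
Qed.
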